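(* There is an absolute constant $C$ such that the following holds. Let $p$ be an odd prime and let $n,s$ be positive integers with $s<2n$ and $2n/s$ an odd integer; put $q=p^n$ and $d=p^s$. Let $f(X)=X^{d+1}\in\mathbb{F}_{q^2}[X]$ (which is a planar polynomial). Then \[ \chi(G_f) \leq 2q + C\,\frac{q}{\log q}. \]
   Context: Let $Q$ be a power of an odd prime. A polynomial $f(X)\in\mathbb{F}_Q[X]$ is planar if for every $a\in\mathbb{F}_Q^*$ the map $x\mapsto f(x+a)-f(x)$ is a bijection of $\mathbb{F}_Q$. For planar $f$, the projective plane $\Pi_f$ has point set $\{(x,y):x,y\in\mathbb{F}_Q\}\cup\{(x):x\in\mathbb{F}_Q\}\cup\{(\infty)\}$ and lines $[a,b]=\{(x,f(x-a)+b):x\in\mathbb{F}_Q\}\cup\{(a)\}$, $[c]=\{(c,y):y\in\mathbb{F}_Q\}\cup\{(\infty)\}$, $[\infty]=\{(c):c\in\mathbb{F}_Q\}\cup\{(\infty)\}$, with incidence being containment. Its polarity $\omega$ is given by $(\infty)^\omega=[\infty]$, $[\infty]^\omega=(\infty)$, $(c)^\omega=[-c]$, $[c]^\omega=(-c)$, $(x,y)^\omega=[-x,-y]$, $[a,b]^\omega=(-a,-b)$. The graph $G_f$ has the points of $\Pi_f$ as vertices, distinct $p_1,p_2$ being adjacent iff $p_1\in p_2^\omega$. Here $Q=q^2$. $\chi$ denotes the chromatic number. *)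

(* Defs.v *)
From mathcomp Require Import all_boot all_order all_algebra all_field.
Set Implicit Arguments. Unset Strict Implicit. Unset Printing Implicit Defensive.
Import GRing.Theory.
Local Open Scope ring_scope.

Section Chromatic.
Variable T : finType.

Definition proper_coloring (e : rel T) (k : nat) (c : T -> 'I_k) : Prop :=
  forall x y, e x y -> c x != c y.

Definition colorableb (e : rel T) (k : nat) : bool :=
  [exists c : {ffun T -> 'I_k}, [forall x, [forall y, e x y ==> (c x != c y)]]].

(* least k such that e is properly k-colourable; every loopless graph on T is
   #|T|-colourable, so the minimum below ranges over a non-empty set for such e *)
Definition chromatic_number (e : rel T) : nat :=
  \big[minn/#|T|]_(k < #|T|.+1 | colorableb e k) (k : nat).
End Chromatic.

Section Plane.
Variable F : finFieldType.
Variable f : F -> F.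

(* points:  inl (x,y) = (x,y);  inr (Some c) = (c);  inr None = (oo)
   lines:   inl (a,b) = [a,b];  inr (Some c) = [c];  inr None = [oo]   *)
Definition point := ((F * F) + option F)%type.
Definition line := ((F * F) + option F)%type.

Definition incident (P : point) (L : line) : bool :=
  match P, L with
  | inl (x, y), inl (a, b) => y == f (x - a) + b
  | inl (x, _), inr (Some c) => x == c
  | inl _, inr None => false
  | inr (Some c), inl (a, _) => c == a
  | inr (Some _), inr (Some _) => false
  | inr (Some _), inr None => true
  | inr None, inl _ => false
  | inr None, inr _ => true
  end.

Definition polarity (P : point) : line :=
  match P with
  | inl (x, y) => inl (- x, - y)
  | inr (Some c) => inr (Some (- c))
  | inr None => inr None
  end.

Definition Gf : rel point := fun p1 p2 => (p1 != p2) && incident p1 (polarity p2).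
End Plane.

(* Main.v *)
(* Write N(u) = u^(d+1), a quadratic map, and replace the ordinate y of an affine
   point by its height z = y - 2 N(x).  The parallelogram law for N turns
   adjacency into z + z' = - N(x - x').  So if V and W are additive subgroups
   with N(V) contained in W, the points whose abscissa lies in one coset of V and
   whose height lies outside W can be coloured with two colours, one for each half
   of (F / W) \ {0}.

   Taking V = W = F_q disposes of all heights outside F_q with 2q colours.  On the
   remaining points adjacency forces N(u) in F_q for u = x - x', which means
   u^q = u or u^q = -u.  Fix mu with mu^q = - mu and an F_p-subspace V' of F_q of
   dimension k, and use the subgroup of index q / p^k of all x such that
   (x + x^q) + (x - x^q) / mu lies in V': its elements u with N(u) in F_q satisfy
   N(u) in N(V') + N(mu) N(V'), whose span W' has at most p^(2k^2) elements.  This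
   disposes of all heights outside W' with 2 q / p^k further colours.  Since N is
   at most two-to-one, the points with height in W' span a graph of degree at most
   2 |W'|, which is coloured greedily.  Choosing k of order sqrt n makes both
   contributions O(q / p^k), and log q = O(p^k). *)

Require Import Defs.
From Stdlib Require Import Reals Lra.
From mathcomp Require Import all_boot all_order all_algebra all_field.
From mathcomp Require Import ring zify.

Set Implicit Arguments.
Unset Strict Implicit.
Unset Printing Implicit Defensive.

Import GRing.Theory.

(** * Partial colourings and the chromatic number *)

Section Coloring.

Variables (T : finType) (e : rel T).

(** Colours are natural numbers constrained only on [P], so that colourings of pieces can be glued
    by shifting. *)
Definition colorable_on (P : pred T) (k : nat) : Prop :=
  exists c : T -> nat, (forall x, P x -> c x < k) /\
    (forall x y, P x -> P y -> e x y -> c x != c y).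

Lemma colorable_on_sub (P Q : pred T) k l :
  (forall x, P x -> Q x) -> k <= l -> colorable_on Q k -> colorable_on P l.
Proof.
move=> sPQ le_kl [c [ltc cP]]; exists c; split=> [x /sPQ /ltc ltx | x y /sPQ Qx /sPQ].
  exact: leq_trans ltx le_kl.
exact: cP.
Qed.

Lemma colorable_onU (P Q : pred T) k l :
  colorable_on P k -> colorable_on Q l ->
  colorable_on (fun x => P x || Q x) (k + l).
Proof.
move=> [c [ltc cP]] [c' [ltc' cP']].
exists (fun x => if P x then c x else k + c' x); split=> [x | x y].
  by case: ifP => [/ltc | _ /= /ltc']; lia.
case: ifP => [Px _ | _ Qx]; case: ifP => [Py _ | _ Qy].
- exact: cP.
- by move=> _; have := ltc _ Px; lia.
- by move=> _; have := ltc _ Py; lia.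
- by rewrite eqn_add2l; apply: cP'.
Qed.

Lemma colorable_on_image (D : finType) (A : {set D}) (c : T -> D) (P : pred T) :
  (forall x, P x -> c x \in A) ->
  (forall x y, P x -> P y -> e x y -> c x != c y) -> colorable_on P #|A|.
Proof.
move=> cA cP; exists (fun x => index (c x) (enum A)).
split=> [x /cA | x y Px Py exy]; first by rewrite cardE index_mem mem_enum.
apply: contra (cP _ _ Px Py exy) => /eqP eq_i; apply/eqP.
rewrite -(nth_index (c x) (s := enum A) (x := c x)) ?mem_enum ?cA //.
by rewrite eq_i nth_index ?mem_enum ?cA.
Qed.

Lemma colorable_on_greedy (P : pred T) k :
  symmetric e -> irreflexive e ->
  (forall x, P x -> #|[set y | P y && e x y]| < k) -> colorable_on P k.
Proof.
move=> e_sym e_irr degP.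
suff: forall s : seq T, colorable_on [pred x | (x \in s) && P x] k.
  by move/(_ (enum T)); apply: colorable_on_sub => // x /=; rewrite mem_enum.
elim=> [|x s [c [ltc cP]]]; first by exists (fun=> 0).
have [Px | nPx] := boolP (P x); last first.
  exists c; split=> [y | y z] /=; rewrite !inE.
    case/andP=> /orP[/eqP-> Px | sy Py]; first by rewrite Px in nPx.
    by apply: ltc; rewrite /= sy.
  case/andP=> /orP[/eqP-> Px | sy Py]; first by rewrite Px in nPx.
  case/andP=> /orP[/eqP-> Px | sz Pz]; first by rewrite Px in nPx.
  by apply: cP; rewrite /= ?sy ?sz.
pose used := [seq c y | y in [set y | P y && e x y]].
(* Pigeonhole: fewer than [k] neighbours of [x] lie in [P], so some colour is free for [x]. *)
have /existsP[i iNused] : [exists i : 'I_k, (i : nat) \notin used].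
  apply: contraT; rewrite negb_exists => /forallP used_all.
  have: size (iota 0 k) <= size used.
    apply: uniq_leq_size (iota_uniq _ _) _ => j; rewrite mem_iota add0n /= => ltj.
    by have := used_all (Ordinal ltj); rewrite negbK.
  by rewrite size_iota size_map -cardE leqNgt degP.
have usedP y : P y -> e x y -> (i : nat) != c y.
  move=> Py exy; apply: contra iNused => /eqP->.
  by apply: map_f; rewrite mem_enum inE Py.
exists (fun y => if y == x then i : nat else c y); split=> [y | y z] /=; rewrite !inE.
  by case: eqP => //= _ ?; apply: ltc.
case: (eqVneq y x) => [-> _ | yx Py]; case: (eqVneq z x) => [-> _ | zx Pz] /=.
- by rewrite e_irr.
- by apply: usedP; case/andP: Pz.
- by rewrite e_sym eq_sym; apply: usedP; case/andP: Py.
- exact: cP.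
Qed.

Lemma bigminn_le_idx (I : Type) (r : seq I) (P : pred I) (f : I -> nat) i0 :
  \big[minn/i0]_(i <- r | P i) f i <= i0.
Proof. by elim/big_rec: _ => // i m _; rewrite geq_min => ->; rewrite orbT. Qed.

Lemma bigminn_le_term (I : finType) (P : pred I) (f : I -> nat) i0 j :
  P j -> \big[minn/i0]_(i | P i) f i <= f j.
Proof.
rewrite -big_filter => Pj; have: j \in [seq i <- index_enum I | P i].
  by rewrite mem_filter Pj mem_index_enum.
elim: [seq i <- _ | _] => //= i r IH; rewrite big_cons inE geq_min.
by case/orP=> [/eqP-> | /IH ->]; rewrite ?leqnn ?orbT.
Qed.

Lemma chromatic_number_le k : colorable_on predT k -> chromatic_number e <= k.
Proof.
case=> c [ltc cP]; rewrite /chromatic_number.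
(* The minimum ranges only over [k <= #|T|]; beyond that its default value [#|T|] is small
   enough. *)
have [le_kT | lt_Tk] := leqP k #|T|; last first.
  exact: leq_trans (bigminn_le_idx _ _ _ _) (ltnW lt_Tk).
pose j := Ordinal (le_kT : k < #|T|.+1); rewrite -[leqRHS]/(val j).
apply: bigminn_le_term; rewrite /colorableb.
apply/existsP; exists [ffun x => Ordinal (ltc x isT)].
apply/forallP=> x; apply/forallP=> y; apply/implyP=> exy; rewrite !ffunE.
exact: cP.
Qed.

End Coloring.

(** * Subspaces and quotients over the prime field *)

Section LinearAlgebra.

Local Open Scope ring_scope.

Variables (F : finFieldType) (p : nat) (charFp : p \in [pchar F]).

Local Notation L := (pPrimeCharType charFp).

Lemma morph_add0 (h : F -> F) : {morph h : x y / x + y} -> h 0 = 0.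
Proof. by move=> hD; apply: (@addrI _ (h 0)); rewrite -hD !addr0. Qed.

Lemma morph_addMn (h : F -> F) x n : {morph h : x y / x + y} -> h (x *+ n) = h x *+ n.
Proof.
by move=> hD; elim: n => [|n IHn]; rewrite ?(morph_add0 hD) // !mulrS hD IHn.
Qed.

(** Scalars of the prime field act as natural multiples, so additivity of [h] and closure of [P]
    under sums suffice. *)
Lemma span_morph_closed (X : seq L) (h : F -> F) (P : pred F) :
  {morph h : x y / x + y} -> P 0 -> (forall x y, P x -> P y -> P (x + y)) ->
  (forall x, x \in X -> P (h x)) -> forall v : L, v \in <<X>>%VS -> P (h v).
Proof.
move=> hD P0 PD PX v.
rewrite -[X]/(tval (in_tuple X)) => /coord_span ->.
elim/big_ind: _ => [|x y Px Py|i _]; first by rewrite (morph_add0 hD).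
  by rewrite hD PD.
set a := coord _ _ _; rewrite -[_ *: _]/((a : nat)%:R * (X`_i : F)) mulr_natl.
rewrite (morph_addMn _ _ hD); elim: (a : nat) => // n IHn.
by rewrite mulrS PD // PX // mem_nth.
Qed.

(** A model of the quotient map by [U] with values in [F] itself: the projection onto a complement
    of [U]. *)
Definition quotient_by (U : {vspace L}) : F -> F := fun v => v - projv U v.

Lemma quotient_byD U : {morph quotient_by U : x y / x + y}.
Proof. by move=> x y; rewrite /quotient_by linearD /= opprD addrACA. Qed.

Lemma quotient_by_eq0 U v : (quotient_by U v == 0) = (v \in U).
Proof.
rewrite /quotient_by subr_eq0; apply/eqP/idP => [-> | /projv_id-> //].
exact: memv_proj.
Qed.

(** Rank-nullity for the restriction of the quotient map to [K]. *)
Lemma card_quotient_by (U K : {vspace L}) :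
  (U <= K)%VS -> (#|[set quotient_by U x | x in K]| * p ^ \dim U = p ^ \dim K)%N.
Proof.
move=> sUK; pose f : 'End(L) := (\1 - projv U)%VF.
have fE x : f x = quotient_by U x by rewrite !lfunE /= !lfunE.
have kerf : (K :&: lker f)%VS = U.
  apply/vspaceP=> x; rewrite memv_cap memv_ker fE quotient_by_eq0 andbC.
  by case Ux: (x \in U) => //=; apply: subvP Ux.
have pr_p := pcharf_prime charFp.
have -> : #|[set quotient_by U x | x in K]| = #|(f @: K)%VS|.
  apply: eq_card => y; apply/imsetP/memv_imgP => [] [x Kx ->]; exists x => //.
rewrite card_vspace card_Fp // -expnD -(limg_ker_dim f K) kerf addnC //.
Qed.

Lemma card_lin_vspace (U : {vspace L}) : #|U| = (p ^ \dim U)%N.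
Proof. by rewrite card_vspace card_Fp // (pcharf_prime charFp). Qed.

(** [pi] kills the span of [k] basis vectors of [K]. By biadditivity of [phi u * w], the [k ^ 2]
    products of these vectors and their multiples by [g] span everything that [rho] has to kill. *)
Lemma exists_small_quotients (K : {set F}) (phi : F -> F) (g : F) (k : nat) :
  0 \in K -> {in K &, forall x y, x + y \in K} -> (p ^ k <= #|K|)%N ->
  {morph phi : x y / x + y} ->
  exists pi rho : F -> F,
    [/\ {morph pi : x y / x + y}, {morph rho : x y / x + y},
        (#|pi @: K| * p ^ k = #|K|)%N,
        forall v, v \in K -> pi v = 0 ->
          rho (phi v * v) = 0 /\ rho (g * (phi v * v)) = 0
      & (#|[set w | rho w == 0%R]| <= p ^ (2 * k ^ 2))%N].
Proof.
move=> K0 KD leK phiD; have pr_p := pcharf_prime charFp.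
pose KV : {vspace L} := <<(enum K : seq L)>>%VS.
have memKV x : (x \in KV) = (x \in K).
  apply/idP/idP => [|Kx]; last by rewrite memv_span ?mem_enum.
  apply: (span_morph_closed (h := id) (P := mem K)) => // y.
  by rewrite mem_enum.
have cardK : #|K| = (p ^ \dim KV)%N.
  by rewrite -card_lin_vspace; apply: eq_card => x; rewrite memKV.
have le_k : (k <= \dim KV)%N by rewrite cardK leq_exp2l ?prime_gt1 in leK.
pose X : seq L := take k (vbasis KV).
have sizeX : size X = k by rewrite size_takel ?size_tuple.
have freeX : free X.
  have /andP[_] := vbasisP KV; rewrite -(cat_take_drop k (vbasis KV)).
  exact: catl_free.
have sXK : (<<X>> <= KV)%VS.
  by apply/span_subvP=> x /mem_take; apply: vbasis_mem.
pose Y : seq L := [seq phi x * y | x <- X, y <- X].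
pose Z : seq L := [seq g * y | y <- Y].
pose W := <<Y ++ Z>>%VS.
have W0 : (0 : F) \in W by apply: mem0v.
have WD (x y : F) : x \in W -> y \in W -> (x + y : F) \in W by apply: memvD.
have prodW (u w : L) : u \in <<X>>%VS -> w \in <<X>>%VS ->
    phi u * w \in W /\ g * (phi u * w) \in W.
  move=> Xu Xw; split.
    apply: (span_morph_closed (h := fun u => phi u * w) (P := mem W)) Xu => //.
      by move=> x y; rewrite phiD mulrDl.
    move=> x Xx.
    apply: (span_morph_closed (h := fun w => phi x * w) (P := mem W)) Xw => //.
      by move=> y z; rewrite mulrDr.
    move=> y Xy; apply: memv_span; rewrite mem_cat; apply/orP; left.
    exact: (allpairs_f (fun a b : F => phi a * b) Xx Xy).
  apply: (span_morph_closed (h := fun u => g * (phi u * w)) (P := mem W)) Xu => //.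
    by move=> x y; rewrite phiD mulrDl mulrDr.
  move=> x Xx.
  apply: (span_morph_closed (h := fun w => g * (phi x * w)) (P := mem W)) Xw => //.
    by move=> y z; rewrite !mulrDr.
  move=> y Xy; apply: memv_span; rewrite mem_cat; apply/orP; right.
  exact: map_f (allpairs_f (fun a b : F => phi a * b) Xx Xy).
exists (quotient_by <<X>>%VS), (quotient_by W); split.
- exact: quotient_byD.
- exact: quotient_byD.
- rewrite cardK -(card_quotient_by sXK) (eqP freeX) sizeX; congr (_ * _)%N.
  apply: eq_card => y; apply/imsetP/imsetP=> [] [x Kx ->]; exists x => //.
    by rewrite memKV.
  by rewrite -memKV.
- move=> v _ /eqP; rewrite quotient_by_eq0 => Xv; have [Wv gWv] := prodW _ _ Xv Xv.
  by split; apply/eqP; rewrite quotient_by_eq0.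
- have -> : #|[set w | quotient_by W w == 0]| = #|W|.
    by apply: eq_card => w; rewrite inE quotient_by_eq0.
  rewrite card_lin_vspace leq_exp2l ?prime_gt1 //.
  apply: leq_trans (dim_span _) _.
  by rewrite size_cat size_map size_allpairs sizeX; lia.
Qed.

End LinearAlgebra.

(** * Frobenius maps and the quadratic map [u ^+ d.+1] *)

Section PolarityGraph.

Local Open Scope ring_scope.

Variables (F : finFieldType) (p n s : nat).
Hypotheses (pr_p : prime p) (odd_p : odd p) (s_gt0 : (0 < s)%N).
Hypotheses (dvd_s : (s %| 2 * n)%N) (odd_quo : odd ((2 * n) %/ s)).
Hypothesis cardF : #|F| = ((p ^ n) ^ 2)%N.

Local Notation q := (p ^ n)%N.
Local Notation d := (p ^ s)%N.

Lemma pchar_polarity_field : p \in [pchar F].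
Proof. by apply: (@card_finPcharP F p (n * 2)) => //; rewrite expnM. Qed.

Let charFp := pchar_polarity_field.

Lemma two_neq0 : (2%:R : F) != 0.
Proof.
rewrite -(dvdn_pcharf charFp); apply/negP=> /dvdn_leq - /(_ isT).
by have := prime_gt1 pr_p; case: (p) odd_p => [|[|[|]]].
Qed.

Lemma double_eq0 (x : F) : x + x = 0 -> x = 0.
Proof.
rewrite -mulr2n -mulr_natl => /eqP; rewrite mulf_eq0 (negPf two_neq0).
by move/eqP.
Qed.

Lemma frobD k (x y : F) : (x + y) ^+ (p ^ k) = x ^+ (p ^ k) + y ^+ (p ^ k).
Proof. by apply: exprDn_pchar; rewrite pnatX (pnatE _ pr_p) charFp. Qed.

Lemma frobN k (x : F) : (- x) ^+ (p ^ k) = - x ^+ (p ^ k).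
Proof.
apply/eqP; rewrite -addr_eq0 -frobD addNr expr0n expn_eq0.
by rewrite -leqn0 leqNgt prime_gt0.
Qed.

Lemma frobB k (x y : F) : (x - y) ^+ (p ^ k) = x ^+ (p ^ k) - y ^+ (p ^ k).
Proof. by rewrite frobD frobN. Qed.

Lemma frob_q_involutive (x : F) : (x ^+ q) ^+ q = x.
Proof. by rewrite -exprM mulnn -cardF expf_card. Qed.

(* The order [2 n / s] of [x |-> x ^ d] is odd, so [-1] is not an eigenvalue. *)
Lemma frob_d_opp_eq0 (w : F) : w ^+ d = - w -> w = 0.
Proof.
move=> wd.
have iter_w i : w ^+ (d ^ i) = if odd i then - w else w.
  elim: i => [|i IHi]; first by rewrite expn0 expr1.
  rewrite expnSr exprM IHi /=; case: (odd i) => /=; rewrite ?frobN wd ?opprK //.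
have : w ^+ (d ^ ((2 * n) %/ s)) = w.
  by rewrite -expnM muln_divCA // mulnC divnn s_gt0 mul1n mulnC expnM -cardF expf_card.
rewrite iter_w odd_quo => wN; apply: double_eq0.
by rewrite -{1}wN addNr.
Qed.

(** This nondegeneracy of the polar form of [u ^+ d.+1] amounts to planarity. Dividing by
    [v * v ^+ d] gives [(u / v) ^+ d = - (u / v)]. *)
Lemma polar_form_eq0 (u v : F) : u ^+ d * v + u * v ^+ d = 0 -> u = 0 \/ v = 0.
Proof.
move=> uv0; have [-> | v0] := eqVneq v 0; [by right | left].
suff /frob_d_opp_eq0/eqP : (u / v) ^+ d = - (u / v).
  by rewrite mulf_eq0 invr_eq0 (negPf v0) orbF => /eqP.
apply/eqP; rewrite -addr_eq0 exprMn exprVn.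
have vd0 : v ^+ d != 0 by rewrite expf_neq0.
apply/eqP; rewrite -[RHS](mul0r (v * v ^+ d)^-1) -uv0.
by move: (u ^+ d) (v ^+ d) vd0 => ud vd vd0; field; rewrite v0 vd0.
Qed.

(** The polar form at [u - v] and [u + v] is twice [u ^+ d.+1 - v ^+ d.+1]. *)
Lemma norm_map_inj (u v : F) : u ^+ d.+1 = v ^+ d.+1 -> u = v \/ u = - v.
Proof.
rewrite !exprSr => uv; have : (u - v) ^+ d * (u + v) + (u - v) * (u + v) ^+ d = 0.
  rewrite frobB frobD; move: (u ^+ d) (v ^+ d) uv => ud vd uv.
  have -> : (ud - vd) * (u + v) + (u - v) * (ud + vd) = 2%:R * (ud * u - vd * v).
    by ring.
  by rewrite uv subrr mulr0.
case/polar_form_eq0 => /eqP; rewrite ?subr_eq0 ?addr_eq0 => /eqP; by [left | right].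
Qed.

Lemma norm_parallelogram (x a : F) :
  (x + a) ^+ d.+1 + (x - a) ^+ d.+1 = 2%:R * x ^+ d.+1 + 2%:R * a ^+ d.+1.
Proof.
by rewrite !exprSr frobB frobD; move: (x ^+ d) (a ^+ d) => xd ad; ring.
Qed.

Definition fix_q : {set F} := [set x | x ^+ q == x].
Definition anti_q : {set F} := [set x | x ^+ q == - x].

Lemma q_gt1 : (1 < q)%N.
Proof.
have := finNzRing_gt1 F; rewrite cardF.
by case: (q) => [|[|]].
Qed.

Lemma card_frob_eigen (c : F) : (#|[set x : F | x ^+ q == c * x]%R| <= q)%N.
Proof.
pose P := 'X^q - c *: 'X : {poly F}.
have sizeP : size P = q.+1.
  rewrite size_polyDl size_polyXn // size_polyN ltnS.
  by apply: leq_trans (size_scale_leq _ _) _; rewrite size_polyX q_gt1.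
rewrite -ltnS -sizeP cardE; apply: max_poly_roots; rewrite ?enum_uniq //.
  by rewrite -size_poly_eq0 sizeP.
apply/allP=> x; rewrite mem_enum inE => /eqP xq.
by rewrite rootE !hornerE ?hornerXn xq subrr.
Qed.

Lemma card_anti_q : (#|anti_q| <= q)%N.
Proof.
apply: leq_trans (card_frob_eigen (-1)).
by rewrite leq_eqVlt; apply/orP/or_introl/eqP/eq_card=> x; rewrite !inE mulN1r.
Qed.

(** Root counting bounds both eigenspaces of [x ^+ q] by [q]; since [x] is recovered from
    [x + x ^+ q] and [x - x ^+ q], their product has at least [q ^ 2] elements. *)
Lemma card_fix_q : #|fix_q| = q.
Proof.
apply/eqP; rewrite eqn_leq; apply/andP; split.
  apply: leq_trans (card_frob_eigen 1).
  by rewrite leq_eqVlt; apply/orP/or_introl/eqP/eq_card=> x; rewrite !inE mul1r.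
have : (q * q <= #|fix_q| * #|anti_q|)%N.
  rewrite mulnn -cardF -cardsX -cardsT.
  pose h (x : F) := (x + x ^+ q, x - x ^+ q).
  rewrite -(card_imset (f := h) [set: F]).
    apply/subset_leq_card/subsetP=> _ /imsetP[x _ ->].
    by rewrite !inE /= frobB frobD frob_q_involutive addrC opprB !eqxx.
  move=> x y [eqD eqB]; apply/eqP; rewrite -subr_eq0; apply/eqP/double_eq0.
  have -> : x - y + (x - y) = (x + x ^+ q) + (x - x ^+ q) - (y + y ^+ q) - (y - y ^+ q).
    by move: (x ^+ q) (y ^+ q) => xq yq; ring.
  by rewrite eqD eqB; move: (y ^+ q) => yq; ring.
move/leq_trans/(_ (leq_mul (leqnn _) card_anti_q)).
by rewrite leq_pmul2r // ltnW // q_gt1.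
Qed.

(** The hypothesis says that [u ^+ q] and [u] have the same image under the quadratic map. *)
Lemma norm_in_fix_q (u : F) : u ^+ d.+1 \in fix_q -> u ^+ q = u \/ u ^+ q = - u.
Proof.
by rewrite inE -exprM mulnC exprM => /eqP; apply: norm_map_inj.
Qed.

Lemma exists_anti_q : exists2 mu : F, mu != 0 & mu ^+ q = - mu.
Proof.
have /exists_inP[x _ xq] : [exists x in [set: F], x \notin fix_q].
  apply: contraT; rewrite negb_exists_in => /forall_inP allK.
  have : (#|F| <= #|fix_q|)%N.
    rewrite -cardsT; apply/subset_leq_card/subsetP=> x Tx.
    by have := allK x Tx; rewrite negbK.
  by rewrite cardF card_fix_q -mulnn; have := q_gt1; move: (q) => Q; nia.
exists (x ^+ q - x); first by rewrite subr_eq0; rewrite inE in xq.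
by rewrite frobB frob_q_involutive opprB.
Qed.

(** An arbitrary choice of one element in each pair of distinct opposites, made through the
    enumeration of [F]. *)
Definition half (z : F) : bool := (enum_rank z < enum_rank (- z))%N.

Lemma half_opp (z z' : F) : z != 0 -> z + z' = 0 -> half z != half z'.
Proof.
move=> z0 /eqP; rewrite addrC addr_eq0 => /eqP->; rewrite /half opprK.
case: ltngtP => // /val_inj/enum_rank_inj zz.
by move/eqP: z0; case; apply: double_eq0; rewrite [in X in X + _]zz addNr.
Qed.

(** * The graph in terms of abscissa and height *)

Definition height (P : point F) : F :=
  if P is inl (x, y) then y - 2%:R * x ^+ d.+1 else 0.
Definition abscissa (P : point F) : F := if P is inl (x, _) then x else 0.
Definition affine (P : point F) : bool := if P is inl _ then true else false.

Local Notation G := (Gf (fun x : F => x ^+ d.+1)).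

(* In the coordinate [height] the graph is invariant under translations of the
   abscissa. *)
Lemma Gf_affine P1 P2 : affine P1 -> affine P2 -> G P1 P2 ->
  height P1 + height P2 = - (abscissa P1 - abscissa P2) ^+ d.+1.
Proof.
case: P1 => // [[x y]] _; case: P2 => // [[a b]] _ /andP[_] /= /eqP->.
have := norm_parallelogram x a; rewrite opprK.
move: ((x + a) ^+ _) ((x - a) ^+ _) (x ^+ _) (a ^+ _) => A B X Y AB.
have -> : A = 2%:R * X + 2%:R * Y - B by rewrite -AB addrK.
by ring.
Qed.

Lemma affine_inj P1 P2 : affine P1 -> affine P2 ->
  abscissa P1 = abscissa P2 -> height P1 = height P2 -> P1 = P2.
Proof.
by case: P1 => // [[x y]] _; case: P2 => // [[a b]] _ /= -> /addIr ->.
Qed.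

Lemma Gf_sym : symmetric G.
Proof.
have dec (A B C : F) : (A == B - C) = (A + C == B) by rewrite -subr_eq opprK.
move=> P1 P2; rewrite /Gf; congr (~~ _ && _); first exact: eq_sym.
case: P1 P2 => [[x y]|[c|]] [[a b]|[c'|]] //=.
- by rewrite !opprK !dec [x + a]addrC [y + b]addrC.
- by rewrite -eqr_oppLR eq_sym.
- by rewrite -eqr_oppLR eq_sym.
Qed.

Lemma Gf_irr : irreflexive G.
Proof. by move=> P; rewrite /Gf eqxx. Qed.

(** The points at infinity span a star centred at [(oo)]. *)
Lemma colorable_infinite : colorable_on G (fun P => ~~ affine P) 2.
Proof.
rewrite -card_bool -cardsT.
apply: (colorable_on_image (c := fun P : point F => P == inr None)) => [P|] //.
by move=> [[? ?]|[c|]] [[? ?]|[c'|]] // _ _; rewrite /Gf ?eqxx ?andbF.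
Qed.

Lemma colorable_height_notin_fix_q :
  colorable_on G (fun P => affine P && (height P \notin fix_q)) (2 * q).
Proof.
have le_colors : (#|setX anti_q [set: bool]| <= 2 * q)%N.
  by rewrite cardsX cardsT card_bool mulnC leq_mul2l card_anti_q.
apply: (colorable_on_sub _ le_colors) => [P HP|]; first exact: HP.
(* The additive map [x - x ^+ q] has kernel [fix_q], so the first entry encodes the coset of the
   abscissa; the second picks a half of the nonzero classes of heights. *)
pose c P := (abscissa P - abscissa P ^+ q, half (height P ^+ q - height P)).
apply: (colorable_on_image (c := c)) => [P _ | P1 P2].
  by rewrite !inE /= frobB frob_q_involutive opprB eqxx.
case/andP=> aff1 h1 /andP[aff2 h2] /(Gf_affine aff1 aff2).
set z1 := height P1 in h1 *; set z2 := height P2 in h2 * => eqz.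
apply/negP=> /eqP[eqx eqh].
suff /negP[] : half (z1 ^+ q - z1) != half (z2 ^+ q - z2) by apply/eqP.
apply: half_opp; first by rewrite subr_eq0; rewrite inE in h1.
set u := abscissa P1 - abscissa P2 in eqz.
have uq : u ^+ q = u.
  have swap_sub (x1 x2 y1 y2 : F) : x1 - y1 = x2 - y2 -> y1 - y2 = x1 - x2.
    by move=> /(canRL (subrK _)) ->; ring.
  by rewrite frobB; apply: swap_sub.
have -> : z1 ^+ q - z1 + (z2 ^+ q - z2) = (z1 + z2) ^+ q - (z1 + z2).
  by rewrite frobD; move: (z1 ^+ q) (z2 ^+ q) => a b; ring.
by rewrite eqz frobN -exprM mulnC exprM uq subrr.
Qed.

(** * Points with height in [fix_q] *)

Section Quotients.

Variables (mu : F) (pi rho : F -> F).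
Hypotheses (mu_neq0 : mu != 0) (mu_anti : mu ^+ q = - mu).
Hypotheses (piD : {morph pi : x y / x + y}) (rhoD : {morph rho : x y / x + y}).
Hypothesis rho_norm : forall v, v \in fix_q -> pi v = 0 ->
  rho (v ^+ d * v) = 0 /\ rho (mu ^+ d.+1 * (v ^+ d * v)) = 0.

(** It equals [2 u] if [u ^+ q = u] and [2 u / mu] if [u ^+ q = - u], so a single condition in
    [fix_q] controls both eigenspaces. *)
Definition twist (x : F) : F := x + x ^+ q + (x - x ^+ q) / mu.

Lemma twistB : {morph twist : x y / x - y}.
Proof.
move=> x y; rewrite /twist frobB; move: (x ^+ q) (y ^+ q) => xq yq.
by field.
Qed.

Lemma frob_div_mu (x : F) : (x / mu) ^+ q = - (x ^+ q / mu).
Proof. by rewrite exprMn exprVn mu_anti invrN mulrN. Qed.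

Lemma twist_fix_q x : twist x \in fix_q.
Proof.
rewrite inE /twist !frobD frob_div_mu frobB frob_q_involutive -mulNr opprB.
by rewrite [x ^+ q + x]addrC.
Qed.

Lemma pi_double (v : F) : pi (v + v) = 0 -> pi v = 0.
Proof. by rewrite piD; apply: double_eq0. Qed.

(** If [u ^+ q = - u], then [u / mu] lies in [fix_q] and [u ^+ d.+1] is [mu ^+ d.+1] times its
    image; this is why the multiples by [mu ^+ d.+1] are killed too. *)
Lemma rho_norm_twist (u : F) :
  u ^+ d.+1 \in fix_q -> pi (twist u) = 0 -> rho (u ^+ d.+1) = 0.
Proof.
case/norm_in_fix_q => uq; rewrite /twist uq.
  rewrite subrr mul0r addr0 => /pi_double piu.
  by rewrite exprSr; case: (rho_norm _ piu); rewrite // inE uq.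
rewrite subrr add0r opprK mulrDl => /pi_double piu.
have Ku : u / mu \in fix_q by rewrite inE frob_div_mu uq mulNr opprK.
have [_] := rho_norm Ku piu.
by rewrite -exprSr -exprMn mulrC divfK.
Qed.

Lemma colorable_height_in_fix_q :
  colorable_on G
    (fun P => [&& affine P, height P \in fix_q & rho (height P) != 0])
    (2 * #|pi @: fix_q|).
Proof.
have -> : (2 * #|pi @: fix_q|)%N = #|setX (pi @: fix_q) [set: bool]|.
  by rewrite cardsX cardsT card_bool mulnC.
pose c P := (pi (twist (abscissa P)), half (rho (height P))).
apply: (colorable_on_image (c := c)) => [P _ | P1 P2].
  by rewrite inE in_setT andbT /= imset_f // twist_fix_q.
case/and3P=> aff1 h1 rho1 /and3P[aff2 h2 _] /(Gf_affine aff1 aff2).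
set z1 := height P1 in h1 rho1 *; set z2 := height P2 in h2 * => eqz.
apply/negP=> /eqP[eqx eqh].
suff /negP[] : half (rho z1) != half (rho z2) by apply/eqP.
apply: half_opp => //; rewrite -rhoD eqz.
set u := abscissa P1 - abscissa P2 in eqz *.
have Ku : u ^+ d.+1 \in fix_q.
  rewrite -[u ^+ _]opprK -eqz; move: h1 h2; rewrite !inE => /eqP h1 /eqP h2.
  by rewrite frobN frobD h1 h2.
have piu : pi (twist u) = 0.
  by apply: (@addIr _ (pi (twist (abscissa P2)))); rewrite -piD twistB subrK add0r.
have rho0 : rho 0 = 0 by apply: morph_add0.
by apply: (@addIr _ (rho (u ^+ d.+1))); rewrite -rhoD addNr rho_norm_twist // addr0.
Qed.

Lemma card_norm_preim (W : {set F}) : (#|[set u | u ^+ d.+1 \in W]| <= 2 * #|W|)%N.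
Proof.
rewrite mulnC -sum_nat_const; set A := [set u | _].
rewrite -sum1_card (partition_big (fun u => u ^+ d.+1) (mem W)) /=; last first.
  by move=> u; rewrite inE.
apply: leq_sum => w Ww; rewrite sum1_card.
have [v /andP[_ /eqP vw] | none] := pickP [pred u | (u \in A) && (u ^+ d.+1 == w)].
  apply: leq_trans (_ : #|[set v; - v]| <= 2)%N; last by rewrite cards2; case: eqP.
  apply/subset_leq_card/subsetP=> u; rewrite unfold_in => /andP[_ /eqP uw].
  by rewrite !inE; case: (@norm_map_inj u v) => [|->|->]; rewrite ?uw ?vw ?eqxx ?orbT.
by rewrite (eq_card0 (A := _)).
Qed.

(** A neighbour is determined by the difference of abscissas, whose image under the two-to-one
    quadratic map lies in the kernel of [rho]. *)
Lemma colorable_height_ker_rho :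
  colorable_on G (fun P => affine P && (rho (height P) == 0))
    (2 * #|[set w | rho w == 0%R]|).+1.
Proof.
apply: colorable_on_greedy => [||P1 /andP[aff1 /eqP rho1]].
- exact: Gf_sym.
- exact: Gf_irr.
rewrite ltnS; set N1 := [set P2 | _].
apply: leq_trans (card_norm_preim _).
rewrite -(card_in_imset (f := fun P => abscissa P1 - abscissa P) (D := N1)).
  apply/subset_leq_card/subsetP=> _ /imsetP[P2 + ->].
  rewrite !inE => /andP[/andP[aff2 /eqP rho2]] /(Gf_affine aff1 aff2) eqz.
  have rho0 : rho 0 = 0 by apply: morph_add0.
  rewrite -[rho _]addr0 -[X in _ + X](_ : rho (height P1 + height P2) = 0); last first.
    by rewrite rhoD rho1 rho2 addr0.
  by rewrite -rhoD eqz subrr rho0.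
move=> P2 P3; rewrite !inE => /andP[/andP[aff2 _]] /(Gf_affine aff1 aff2) eq2.
move=> /andP[/andP[aff3 _]] /(Gf_affine aff1 aff3) eq3 eqx.
have eqa : abscissa P2 = abscissa P3 by apply: oppr_inj; apply: addrI eqx.
by apply: affine_inj => //; apply: (@addrI _ (height P1)); rewrite eq2 eq3 eqa.
Qed.

End Quotients.

(** The final [3] collects two colours for the points at infinity and the extra one of the greedy
    colouring. *)
Lemma chromatic_number_polarity_le (k : nat) : (k <= n)%N ->
  (chromatic_number G <= 2 * q + 2 * p ^ (n - k) + 2 * p ^ (2 * k ^ 2) + 3)%N.
Proof.
move=> le_kn; have [mu mu0 mu_anti] := exists_anti_q.
have K0 : 0 \in fix_q by rewrite inE -[X in X ^+ _](subrr 0) frobB subrr.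
have KD : {in fix_q &, forall x y, x + y \in fix_q}.
  by move=> x y; rewrite !inE frobD => /eqP-> /eqP->.
have leK : (p ^ k <= #|fix_q|)%N by rewrite card_fix_q leq_exp2l ?prime_gt1.
have [pi [rho [piD rhoD cardpi rho_norm cardrho]]] :=
  exists_small_quotients charFp (mu ^+ d.+1) K0 KD leK (@frobD s).
have cardpi' : #|pi @: fix_q| = (p ^ (n - k))%N.
  apply/eqP; rewrite -(@eqn_pmul2r (p ^ k)) ?expn_gt0 ?prime_gt0 //.
  by rewrite cardpi card_fix_q -expnD subnK.
have col1 := colorable_onU colorable_infinite colorable_height_notin_fix_q.
have col2 := colorable_onU
  (colorable_height_in_fix_q mu0 mu_anti piD rhoD rho_norm)
  (colorable_height_ker_rho rhoD).
apply: chromatic_number_le; apply: colorable_on_sub (colorable_onU col1 col2).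
  move=> P _ /=; case: (affine P) => //=.
  by case: (_ \in _) => //=; case: (_ == _).
by rewrite cardpi'; lia.
Qed.

End PolarityGraph.

(** * Estimating [log q] and choosing [k] *)

Lemma INR_expn (a m : nat) : INR (a ^ m) = pow (INR a) m.
Proof. by elim: m => [|m IHm] //=; rewrite expnS mult_INR IHm. Qed.

Section LogarithmBound.

Local Open Scope R_scope.

(** Square [x / 2 <= exp (x / 2)]. *)
Lemma sqr_le_exp (x : R) : 0 <= x -> x * x <= 4 * exp x.
Proof.
move=> x_ge0; have := exp_ineq1_le (x / 2).
have -> : exp x = exp (x / 2) * exp (x / 2) by rewrite -exp_plus; congr exp; lra.
by move=> h; nra.
Qed.

(** With [L = k ln a] and [ln a >= 1], [n ln a <= 9 L ^ 2 <= 36 exp L]. *)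
Lemma ln_expn_le (a n k : nat) : (2 < a)%N -> (n <= 9 * k ^ 2)%N ->
  ln (INR (a ^ n)) <= 36 * INR (a ^ k).
Proof.
move=> a_gt2 le_n.
have le3a : 3 <= INR a by have -> : 3 = INR 3 by [rewrite /=; lra]; apply/le_INR/leP.
have ln_a : 1 <= ln (INR a).
  apply: Rnot_lt_le => /exp_increasing; rewrite exp_ln; have := exp_le_3; lra.
have le_nk : INR n <= 9 * (INR k * INR k).
  have -> : 9 = INR 9 by [rewrite /=; lra].
  by rewrite -mulnn in le_n; rewrite -!mult_INR; apply/le_INR/leP.
have k_ge0 := pos_INR k.
have -> : INR (a ^ k) = exp (INR k * ln (INR a)).
  by rewrite INR_expn -ln_pow ?exp_ln //; [apply: pow_lt | ]; lra.
rewrite INR_expn ln_pow; last lra.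
have L_ge0 : 0 <= INR k * ln (INR a) by nra.
have := sqr_le_exp L_ge0.
have : INR n * ln (INR a) <= 9 * (INR k * INR k) * ln (INR a).
  by apply: Rmult_le_compat_r => //; lra.
have : INR k * INR k * ln (INR a) <= INR k * INR k * (ln (INR a) * ln (INR a)).
  by apply: Rmult_le_compat_l; nra.
nra.
Qed.

End LogarithmBound.

Lemma exists_subspace_dim (n : nat) : 2 < n ->
  exists k, 2 * k ^ 2 + k <= n <= 9 * k ^ 2.
Proof.
move=> n_gt2; have ex0 : exists k, 2 * k ^ 2 + k <= n by exists 0.
have bnd k : 2 * k ^ 2 + k <= n -> k <= n by lia.
(* The largest admissible [k] works: it is at least [1] because [n > 2], and then
   [2 k ^ 2 + 5 k + 2 <= 9 k ^ 2]. *)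
case: (ex_maxnP ex0 bnd) => k le_k max_k; exists k; rewrite le_k /=.
have k_gt0 : 0 < k by apply: max_k.
have : n < 2 * k.+1 ^ 2 + k.+1.
  by rewrite ltnNge; apply/negP => /max_k; rewrite ltnn.
by rewrite -!mulnn; nia.
Qed.

Theorem theorem4 :
  exists C : R,
  forall (p n s : nat), prime p -> odd p -> (0 < n)%N -> (0 < s)%N ->
  (s < 2 * n)%N -> (s %| 2 * n)%N -> odd ((2 * n) %/ s) ->
  forall F : finFieldType, #|F| = ((p ^ n) ^ 2)%N ->
  let q := (p ^ n)%N in
  let d := (p ^ s)%N in
  let f := fun x : F => (x ^+ d.+1)%R in
  Rle (INR (chromatic_number (Gf f)))
      (Rplus (Rmult 2 (INR q)) (Rdiv (Rmult C (INR q)) (ln (INR q)))).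
Proof.
(* [252 = 7 * 36]: seven multiples of [p ^ (n - k)], and the constant bounding [ln q] by [p ^ k]. *)
exists (IZR 252) => p n s pr_p odd_p n_gt0 s_gt0 lt_s dvd_s odd_quo F cardF q d f.
(* The odd quotient exceeds [1], so it is at least [3]; hence [s] is even and [2 n >= 6]. *)
have n_gt2 : 2 < n.
  move: dvd_s odd_quo lt_s s_gt0 => /dvdnP[m eq_m]; rewrite eq_m => + + s_gt0.
  by rewrite mulnK // => odd_m lt_sm; have := odd_m; nia.
have p_gt2 : 2 < p by have := prime_gt1 pr_p; case: (p) odd_p => [|[|[|]]].
have [k /andP[le_k le_n]] := exists_subspace_dim n_gt2.
have le_kn : k <= n by lia.
have := chromatic_number_polarity_le pr_p odd_p s_gt0 dvd_s odd_quo cardF le_kn.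
have le_colors : 2 * q + 2 * p ^ (n - k) + 2 * p ^ (2 * k ^ 2) + 3
    <= 2 * q + 7 * p ^ (n - k).
  have : 0 < p ^ (n - k) by rewrite expn_gt0 prime_gt0.
  have : p ^ (2 * k ^ 2) <= p ^ (n - k) by rewrite leq_exp2l ?prime_gt1 //; lia.
  by move: (p ^ (n - k)) (p ^ (2 * k ^ 2)) (q) => A B D; lia.
move=> /leq_trans/(_ le_colors)/leP/le_INR.
rewrite -[Gf _]/(Gf f) plus_INR !mult_INR.
have eq_q : INR q = Rmult (INR (p ^ (n - k))) (INR (p ^ k)).
  by rewrite -mult_INR multE -expnD subnK.
have ln_le := ln_expn_le p_gt2 le_n.
have ln_gt0 : Rlt 0 (ln (INR q)).
  rewrite -ln_1; apply: ln_increasing; first lra.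
  by rewrite -[IZR 1]/(INR 1); apply/lt_INR/ltP; rewrite -(expn0 p) ltn_exp2l; lia.
move/Rle_trans; apply; rewrite -[INR 2]/(Rplus 1 1) [INR 7]/=.
apply: Rplus_le_compat; first lra.
apply: (Rmult_le_reg_r _ _ _ ln_gt0).
rewrite /Rdiv (Rmult_assoc (Rmult _ _)) Rinv_l; last lra.
have := Rmult_le_compat_l _ _ _ (pos_INR (p ^ (n - k))) ln_le; rewrite -/q; lra.
Qed.
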